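(* Let $\mathcal{H}$ be a finite-dimensional complex Hilbert space. Then the norm closure of $\mathfrak{c}(\mathrm{nil}_2) := \{MN - NM : M, N \in \mathcal{B}(\mathcal{H}),\ M^2 = 0 = N^2\}$ equals $\mathrm{Bal}(\mathcal{H})$, the set of balanced operators on $\mathcal{H}$.
   Context: An operator $T \in \mathcal{B}(\mathcal{H})$ is balanced if: (a) $\sigma(T) = \sigma(-T)$; (b) whenever $\Omega_1, \Omega_2 \subseteq \mathbb{C}$ are disjoint open sets with $\sigma(T) \subseteq \Omega_1 \cup \Omega_2$, one has $\dim \mathcal{H}(\Omega_1; T) = \dim \mathcal{H}(-\Omega_1; T)$, where $\mathcal{H}(\Omega; T)$ denotes the range of the Riesz idempotent of $T$ corresponding to the clopen part $\sigma(T) \cap \Omega$ of the spectrum; (c) for every $\alpha \in \mathbb{C}$, $T - \alpha I$ is semi-Fredholm iff $T + \alpha I$ is semi-Fredholm, in which case $\mathrm{ind}(T - \alpha I) = \mathrm{ind}(T + \alpha I)$ (here the semi-Fredholm index is $\dim\ker(T-\alpha I) - \dim\ker(T-\alpha I)^*$). (In finite dimensions this amounts to: $\alpha \in \sigma(T)$ implies $-\alpha \in \sigma(T)$ with equal algebraic multiplicities.) *)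

(* Defs.v *)
From HB Require Import structures.
From mathcomp Require Import all_boot all_order all_algebra.
From mathcomp Require Import complex.
From mathcomp Require Import all_classical all_reals all_analysis.
Set Implicit Arguments. Unset Strict Implicit. Unset Printing Implicit Defensive.
Import Order.TTheory GRing.Theory Num.Theory.
Local Open Scope ring_scope.

(* An operator on a complex Hilbert space of finite dimension n is an
   n x n complex matrix; the complex field is [R[i]] for a real field [R]. *)

Definition alg_mult (C : fieldType) (n : nat) (T : 'M[C]_n) (a : C) : nat :=
  mup a (char_poly T).

Definition balanced (C : fieldType) (n : nat) (T : 'M[C]_n) : Prop :=
  forall a : C, eigenvalue T a ->
    eigenvalue T (- a) /\ alg_mult T a = alg_mult T (- a).

Definition comm_nil2 (C : fieldType) (n : nat) : set 'M[C]_n :=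
  [set T | exists M N : 'M[C]_n,
     M *m M = 0 /\ N *m N = 0 /\ T = M *m N - N *m M]%classic.

Definition Bal (C : fieldType) (n : nat) : set 'M[C]_n :=
  [set T | balanced T]%classic.

(* Norm closure of a set of n x n matrices over a numeric field, for the
   library matrix norm [mx_norm] (max of the moduli of the entries); in finite
   dimension every norm on B(H) (in particular the operator norm) induces
   the same topology, hence the same closure. *)
Definition norm_closure (C : numFieldType) (n : nat) (S : set 'M[C]_n)
  : set 'M[C]_n :=
  [set T | forall e : C, 0 < e -> exists X, S X /\ `|T - X| < e]%classic.

(* Main.v *)
(** If M^2 = N^2 = 0, then [M, N] = (M - N)(M + N) while
    -[M, N] = (M + N)(M - N), so T = [M, N] and -T have the same characteristic
    polynomial.  This is a closed condition on T, and it says that the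
    eigenvalues a and -a have the same multiplicity.

    Conversely, put a balanced T in triangular form and pair each diagonal
    entry a with an entry -a; at most one entry, equal to 0, is left alone.
    Moving the pairs slightly makes all the diagonal entries distinct while the
    spectrum stays symmetric.  The perturbed matrix is then similar to a direct
    sum of blocks diag(b, -b) and possibly a block 0, and
    diag(b, -b) = [b E_12, E_21] is a commutator of square-zero matrices. *)
Require Import Defs.
From HB Require Import structures.
From mathcomp Require Import all_boot all_order all_algebra.
From mathcomp Require Import complex spectral mxred.
From mathcomp Require Import all_classical all_reals all_analysis.
Import Order.TTheory GRing.Theory Num.Theory.
Import numFieldNormedType.Exports.
Local Open Scope classical_set_scope.
Local Open Scope ring_scope.
Set Implicit Arguments.
Unset Strict Implicit.
Unset Printing Implicit Defensive.

(** * Characteristic polynomials and algebraic multiplicities *)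

Lemma char_poly_mulmxC (F : idomainType) (n : nat) (A B : 'M[F]_n) :
  char_poly (A *m B) = char_poly (B *m A).
Proof.
pose Ap := map_mx (@polyC F) A; pose Bp := map_mx (@polyC F) B.
(* Column operations clear [Bp] and leave ['X - AB]; row operations, with the second block row
   scaled by ['X], leave ['X - BA]. The scaling costs the factor ['X^n], cancelled at the end. *)
pose K : 'M[{poly F}]_(n + n) := block_mx 'X%:M Ap Bp 1%:M.
have detAB : \det K = char_poly (A *m B).
  rewrite -[LHS]mulr1 -(det1 _ n) -[\det 1%:M]mul1r -{1}(det1 _ n).
  rewrite -(@det_lblock _ n n 1%:M (- Bp) 1%:M) -det_mulmx mulmx_block.
  rewrite !(mulmx0, mulmx1, mul1mx, add0r) mulmxN addrN det_ublock det1 mulr1.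
  by rewrite /char_poly /char_poly_mx map_mxM.
have detBA : 'X^n * \det K = 'X^n * char_poly (B *m A).
  rewrite -{1}(det_scalar n 'X) -[\det 'X%:M]mul1r -{1}(det1 _ n).
  rewrite -(@det_lblock _ n n 1%:M (- Bp) 'X%:M) -det_mulmx mulmx_block.
  rewrite !(mul0mx, mulmx0, mulmx1, mul1mx, addr0) !mul_scalar_mx.
  rewrite mul_mx_scalar scalerN addNr det_ublock det_scalar.
  by rewrite mulNmx addrC /char_poly /char_poly_mx map_mxM.
by apply: (mulfI (monic_neq0 (monicXn F n))); rewrite -detAB -detBA.
Qed.

Lemma char_poly_conj (F : fieldType) (n : nat) (P A : 'M[F]_n) :
  P \in unitmx -> char_poly (invmx P *m A *m P) = char_poly A.
Proof. by move=> Pu; rewrite char_poly_mulmxC mulmxA mulmxV// mul1mx. Qed.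

Lemma eigenvalue_alg_mult (F : fieldType) (n : nat) (T : 'M[F]_n) (a : F) :
  eigenvalue T a = (0 < alg_mult T a)%N.
Proof.
rewrite eigenvalue_root_char -dvdp_XsubCl XsubC_dvd//.
exact/monic_neq0/char_poly_monic.
Qed.

Lemma trigonalize (C : numClosedFieldType) (n : nat) (T : 'M[C]_n) :
  exists P U : 'M[C]_n,
    [/\ P \in unitmx, is_trig_mx U & T = invmx P *m U *m P].
Proof.
have [|P Pu /= /andP[trigT _]] := @cotrigonalization C n [:: T].
  by move=> A B; rewrite !inE => /eqP-> /eqP->.
have {}Pu := unitarymx_unit Pu.
exists P, (P *m T *m invmx P); split=> //.
  by rewrite -conjumx.
by rewrite !mulmxA mulVmx// mul1mx mulmxKV.
Qed.

Lemma alg_mult_conj_trig (F : fieldType) (n : nat) (P U : 'M[F]_n) (a : F) :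
  P \in unitmx -> is_trig_mx U ->
  alg_mult (invmx P *m U *m P) a = (\sum_i (U i i == a))%N.
Proof.
move=> Pu trigU; rewrite /alg_mult char_poly_conj// char_poly_trig//.
rewrite -(big_map (fun i => U i i) xpredT (fun x => 'X - x%:P)) mu_prod_XsubC.
by rewrite -sum1_count big_mkcond big_map; apply: eq_bigr => i _ /=; case: eqP.
Qed.

Lemma alg_mult_opp (C : numClosedFieldType) (n : nat) (T : 'M[C]_n) (a : C) :
  alg_mult (- T) a = alg_mult T (- a).
Proof.
have [P [U [Pu trigU ->]]] := trigonalize T.
have trigNU : is_trig_mx (- U).
  by apply/is_trig_mxP => i j ij; rewrite mxE (is_trig_mxP trigU)// oppr0.
rewrite -mulNmx -mulmxN !alg_mult_conj_trig//.
by apply: eq_bigr => i _; rewrite mxE eqr_oppLR.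
Qed.

Lemma char_poly_opp_balanced (C : numClosedFieldType) (n : nat) (T : 'M[C]_n) :
  char_poly T = char_poly (- T) -> balanced T.
Proof.
move=> chT a; have multN : alg_mult T a = alg_mult T (- a).
  by rewrite -alg_mult_opp /alg_mult chT.
by rewrite !eigenvalue_alg_mult -multN.
Qed.

(** If neither [a] nor [- a] is an eigenvalue, both multiplicities vanish. *)
Lemma balanced_alg_mult (F : fieldType) (n : nat) (T : 'M[F]_n) (a : F) :
  balanced T -> alg_mult T a = alg_mult T (- a).
Proof.
move=> balT; have [/balT[]//|] := boolP (eigenvalue T a).
have [/balT[+ _]|] := boolP (eigenvalue T (- a)); first by rewrite opprK => ->.
by rewrite !eigenvalue_alg_mult -!eqn0Ngt => /eqP-> /eqP->.
Qed.

Lemma comm_nil2_char_poly_opp (F : fieldType) (n : nat) (T : 'M[F]_n) :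
  comm_nil2 T -> char_poly T = char_poly (- T).
Proof.
move=> [M [N [M2 [N2 ->]]]].
have -> : - (M *m N - N *m M) = (M + N) *m (M - N).
  by rewrite mulmxDl !mulmxBr M2 N2 sub0r subr0 opprB addrC.
rewrite -char_poly_mulmxC; congr char_poly.
by rewrite mulmxBl !mulmxDr M2 N2 add0r addr0.
Qed.

(** * Closedness of the symmetry of the characteristic polynomial *)

Lemma horner_char_poly (F : comNzRingType) (n : nat) (T : 'M[F]_n) (x : F) :
  (char_poly T).[x] = \det (x%:M - T).
Proof.
rewrite -horner_evalE -det_map_mx; congr (\det _); apply/matrixP => i j.
by rewrite !mxE /= horner_evalE !hornerE hornerMn hornerX.
Qed.

Lemma horner_inj (F : numDomainType) (p q : {poly F}) :
  (forall x, p.[x] = q.[x]) -> p = q.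
Proof.
move=> pq; apply/eqP; rewrite -subr_eq0; apply/negP => /negP r0.
pose rs : seq F := [seq k%:R | k <- iota 0 (size (p - q))].
suff: (size rs < size (p - q)%R)%N by rewrite size_map size_iota ltnn.
apply: max_poly_roots r0 _ _.
  by apply/allP => x _; rewrite /root !hornerE pq subrr.
by rewrite map_inj_uniq ?iota_uniq//; exact: mulrIn (oner_neq0 _).
Qed.

(** The Leibniz formula is a polynomial in the entries. With [B] scalar and [c] equal to -1 or 1,
    this covers the characteristic polynomials of [X] and [- X] at a point. *)
Lemma continuous_det_addmx (C : numFieldType) (n : nat) (c : C) (B : 'M[C]_n) :
  continuous (fun X : 'M[C]_n => \det (B + c *: X)).
Proof.
move=> T; rewrite /determinant.
apply: (@cvg_big C _ _ _ _ _ _ (nbhs T)) => [|s _].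
  exact: (@pseudometric_normed_Zmodule.add_continuous C C^o).
apply: cvgM; first exact: cvg_cst.
apply: (@cvg_big C _ _ _ _ _ _ (nbhs T)) => [|i _].
  exact: mul_continuous.
rewrite !mxE; under eq_fun do rewrite !mxE.
apply: cvgD; first exact: cvg_cst.
by apply: cvgM; [exact: cvg_cst | exact: coord_continuous].
Qed.

Lemma norm_closure_char_poly_opp (C : numFieldType) (n : nat) (T : 'M[C]_n) :
  norm_closure (fun X => char_poly X = char_poly (- X)) T ->
  char_poly T = char_poly (- T).
Proof.
move=> clT; apply: horner_inj => x; apply/eqP; rewrite -subr_eq0.
pose f (X : 'M[C]_n) := \det (x%:M + (-1) *: X) - \det (x%:M + 1 *: X).
have fE X : (char_poly X).[x] - (char_poly (- X)).[x] = f X.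
  by rewrite !horner_char_poly /f scaleN1r scale1r opprK.
rewrite fE; apply/negP => /negP fT0.
have cf : f X @[X --> T] --> f T.
  exact: (cvgB (@continuous_det_addmx C n (-1) x%:M T)
               (@continuous_det_addmx C n 1 x%:M T)).
(* Within distance [|f T|] of [f T] there is no zero, yet [f] vanishes at the approximants of
   [T]. *)
have /cvgrPdist_lt/(_ `|f T|) := cf.
rewrite normr_gt0 => /(_ fT0) /nbhs_normP[e /= e0 near_f].
have [X [chX TX]] := clT e e0.
by have := near_f X TX; rewrite /= -(fE X) chX subrr subr0 ltxx.
Qed.

(** * Estimates for the maximum norm *)

Lemma mx_norm_coord (C : numFieldType) (m n : nat) (A : 'M[C]_(m, n)) i j :
  `|A i j| <= `|A|.
Proof.
rewrite [leRHS]/Num.Def.normr /= mx_normE.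
exact: (le_bigmax _ (fun ij => `|A ij.1 ij.2|%:nng) (i, j)).
Qed.

Lemma mx_norm_le (C : numFieldType) (m n : nat) (A : 'M[C]_(m, n)) (c : C) :
  0 <= c -> (forall i j, `|A i j| <= c) -> `|A| <= c.
Proof.
move=> /nonnegP[{}c] Ac; rewrite [leLHS]/Num.Def.normr /= mx_normE num_le.
by apply/bigmax_leP; split=> [|[i j] _]; rewrite -num_le//=.
Qed.

(** The factor [n] counts the terms in an entry of the product. *)
Lemma mx_norm_mulmx (C : numFieldType) (m n p : nat)
    (A : 'M[C]_(m, n)) (B : 'M[C]_(n, p)) :
  `|A *m B| <= n%:R * (`|A| * `|B|).
Proof.
apply: mx_norm_le => [|i j]; first by rewrite !mulr_ge0.
rewrite mxE mulr_natl -[X in _ *+ X]card_ord -sumr_const.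
apply: le_trans (ler_norm_sum _ _ _) _; apply: ler_sum => k _.
by rewrite normrM ler_pM ?mx_norm_coord.
Qed.

(** * Commutators of square-zero matrices *)

Lemma comm_nil2_conj (F : fieldType) (n : nat) (P A : 'M[F]_n) :
  P \in unitmx -> comm_nil2 A -> comm_nil2 (invmx P *m A *m P).
Proof.
move=> Pu [M [N [M2 [N2 ->]]]].
have conjM (X Y : 'M[F]_n) :
    (invmx P *m X *m P) *m (invmx P *m Y *m P) = invmx P *m (X *m Y) *m P.
  by rewrite !mulmxA mulmxK.
exists (invmx P *m M *m P), (invmx P *m N *m P).
by rewrite !conjM M2 N2 mulmx0 mul0mx mulmxBr mulmxBl.
Qed.

(* On each pair {i, s i} exchanged by the involution d (s i) = - d i, the
   commutator is [d_i E_{i, s i}, E_{s i, i}] for the smaller index i. *)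
Lemma comm_nil2_diag (C : numFieldType) (n : nat) (d : 'rV[C]_n) :
  injective (d 0) -> (forall i, exists j, d 0 j = - d 0 i) ->
  comm_nil2 (diag_mx d).
Proof.
move=> d_inj /fin_all_exists[s ds].
have sK : involutive s by move=> i; apply: d_inj; rewrite !ds opprK.
(* The permutation matrix of [s] with row [i] weighted by [a i]; since [s] is an involution, a
   product of two of these is diagonal. *)
pose W (a : 'I_n -> C) : 'M[C]_n := \matrix_(i, j) ((j == s i)%:R * a i).
have WW a b : W a *m W b = diag_mx (\row_i (a i * b (s i))).
  apply/matrixP => i k; rewrite !mxE (bigD1 (s i))//= big1 => [|j ji].
    by rewrite !mxE eqxx mul1r sK addr0 eq_sym mulr_natl mulrnAr.
  by rewrite !mxE (negbTE ji) !mul0r.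
pose a (i : 'I_n) := if (i < s i)%N then d 0 i else 0.
pose b (i : 'I_n) : C := (s i < i)%:R.
have diag0 (f : 'I_n -> C) : (forall i, f i = 0) -> diag_mx (\row_i f i) = 0.
  by move=> f0; apply/matrixP => i j; rewrite !mxE f0 mul0rn.
exists (W a), (W b); rewrite !WW; split; last split.
- by apply: diag0 => i; rewrite /a sK; case: ltngtP; rewrite ?mul0r ?mulr0.
- by apply: diag0 => i; rewrite /b sK; case: ltngtP; rewrite ?mul0r ?mulr0.
apply/matrixP => i j; rewrite !mxE -mulrnBl; congr (_ *+ _).
rewrite /a /b sK; case: ltngtP => [||/val_inj sii].
- by rewrite mulr1 mul0r subr0.
- by rewrite mul0r mul1r ds sub0r opprK.
have /eqP := ds i; rewrite -sii -addr_eq0 -mulr2n mulrn_eq0 /= => /eqP->.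
by rewrite !mul0r subr0.
Qed.

(** Simple roots make [U] diagonalizable; comparing linear factors, its diagonal form permutes the
    diagonal of [U], hence inherits distinctness and symmetry. *)
Lemma comm_nil2_trig (C : numFieldType) (n : nat) (U : 'M[C]_n) :
  is_trig_mx U -> injective (fun i => U i i) ->
  (forall i, exists j, U j j = - U i i) -> comm_nil2 U.
Proof.
case: n U => [|n] U trigU U_inj U_sym.
  by exists 0, 0; rewrite !mulmx0 [U]flatmx0 subrr.
pose us := [seq U i i | i : 'I_n.+1].
have chU : char_poly U = \prod_(x <- us) ('X - x%:P).
  by rewrite char_poly_trig// big_map big_enum.
have us_uniq : uniq us by rewrite map_inj_uniq ?enum_uniq.
have /diagonalizableP[P Pu /(similar_diagLR Pu)[d Ud]] : exists2 rs : seq C,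
    uniq rs & mxminpoly U %| \prod_(x <- rs) ('X - x%:P).
  by exists us => //; rewrite -chU mxminpoly_dvd_char.
rewrite conjVmx// in Ud.
pose ds := [seq d 0 i | i : 'I_n.+1].
have us_ds : perm_eq us ds.
  apply: prod_XsubC_eq; rewrite -chU Ud char_poly_conj//.
  rewrite char_poly_trig ?diag_mx_is_trig// big_map big_enum /=.
  by apply: eq_bigr => i _; rewrite mxE eqxx.
rewrite Ud; apply: comm_nil2_conj => //; apply: comm_nil2_diag.
  by apply/injectiveP; rewrite /injectiveb /dinjectiveb -(perm_uniq us_ds).
move=> i; have : d 0 i \in us by rewrite (perm_mem us_ds); exact: codom_f.
move=> /mapP[k _ ->]; have [j <-] := U_sym k.
have : U j j \in ds by rewrite -(perm_mem us_ds); exact: codom_f.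
by move=> /mapP[l _ ->]; exists l.
Qed.

(** * Symmetric perturbation of a finite family of numbers *)

Lemma exists_near_notin (C : numFieldType) (s : seq C) (u e : C) :
  0 < e -> exists2 w, `|u - w| < e & w \notin s.
Proof.
(* Denominators start at 2 to keep the distance strictly below [e]; [(size s).+1] distinct
   candidates cannot all lie in [s]. *)
move=> e0; pose f k : C := u - e / k.+2%:R.
have f_inj : injective f.
  move=> k l /addrI/oppr_inj/(mulfI (lt0r_neq0 e0))/invr_inj/eqP.
  by rewrite eqr_nat => /eqP[].
have [/allP fs|/allPn[_ /mapP[k _ ->] fks]] :=
    boolP (all (mem s) (map f (iota 0 (size s).+1))).
  have := uniq_leq_size _ fs; rewrite size_map size_iota ltnn.
  by rewrite map_inj_uniq ?iota_uniq => // /(_ isT).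
exists (f k) => //; rewrite /f opprB addrC subrK gtr0_norm ?divr_gt0//.
by rewrite ltr_pdivrMr// ltr_pMr// ltr1n.
Qed.

(** Induction on the size of [A]: remove two distinct indices with opposite values, perturb the
    rest, then give the two fresh values [w] and [- w]. *)
Lemma symmetric_perturbation (C : numFieldType) (I : finType) (u : I -> C)
    (e : C) (A : {set I}) :
  0 < e ->
  (forall a, \sum_(i in A) (u i == a) = \sum_(i in A) (u i == - a))%N ->
  exists v : I -> C,
    [/\ {in A, forall i, `|u i - v i| < e}, {in A &, injective v} &
        {in A, forall i, exists2 j, j \in A & v j = - v i}].
Proof.
move=> e0; have [m] := ubnP #|A|; elim: m A => // m IHm A Am u_sym.
have [/exists_inP[i iA /exists_inP[j jA /andP[ij /eqP uj]]]|/exists_inPn noP] :=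
  boolP [exists i in A, exists j in A, (j != i) && (u j == - u i)]; last first.
  (* Without such a pair, the counts force every value on [A] to be 0, so [A] has at most one
     element and [u] itself works. *)
  have uniqA i j : i \in A -> j \in A -> u j = - u i -> j = i.
    move=> iA jA /eqP uj; apply/eqP; apply: contraNT (noP i iA) => ji.
    by apply/exists_inP; exists j => //; rewrite ji.
  have u0 i : i \in A -> u i = 0.
    move=> iA.
    have [j /andP[jA /eqP uj]|noj] := pickP [pred j in A | u j == - u i].
      have := uj; rewrite (uniqA i j)// => /eqP.
      by rewrite -addr_eq0 -mulr2n mulrn_eq0 => /eqP.
    have := u_sym (u i); rewrite (bigD1 i)//= eqxx [RHS]big1// => j jA.
    by have := noj j; rewrite /= jA /= => ->.
  exists u; split=> [i _|i j iA jA _|i iA]; first by rewrite subrr normr0.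
    by apply: uniqA => //; rewrite !u0// oppr0.
  by exists i => //; rewrite u0// oppr0.
have jAi : j \in A :\ i by rewrite !inE ij.
set B := A :\ i :\ j.
have inA k : k \in A -> [\/ k = i, k = j | k \in B].
  move=> kA; have [->|ki] := eqVneq k i; first by constructor 1.
  have [->|kj] := eqVneq k j; first by constructor 2.
  by constructor 3; rewrite !inE ki kj.
have inB k : k \in B -> [/\ k != i, k != j & k \in A].
  by rewrite !inE => /and3P[].
have [||v [v_near v_inj v_sym]] := IHm B.
- by move: Am; rewrite (cardsD1 i) iA (cardsD1 j) jAi !add1n !ltnS => /ltnW.
(* One of [i], [j] is counted at [a] exactly when the other is counted at [- a], so removing both
   preserves the equality. *)
- move=> a; have := u_sym a; rewrite !(big_setD1 i iA) !(big_setD1 j jAi) /= uj.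
  rewrite !eqr_oppLR opprK addnCA => /eqP.
  by rewrite !eqn_add2l => /eqP.
(* Avoiding 0 separates [w] from [- w]; avoiding each [v k] and [- v k] separates both from the
   earlier values. *)
have [w uw] := @exists_near_notin C
  (0 :: [seq v k | k : I] ++ [seq - v k | k : I]) (u i) e e0.
rewrite inE mem_cat !negb_or => /and3P[w0 /negP wv /negP wNv].
have {}wv k : w <> v k by move=> wE; apply: wv; rewrite wE map_f ?mem_enum.
have {}wNv k : - w <> v k.
  move=> wE; apply: wNv; rewrite -[w]opprK wE.
  by rewrite (map_f (fun k => - v k)) ?mem_enum.
have wNw : w <> - w.
  by move=> /eqP; rewrite -addr_eq0 -mulr2n mulrn_eq0 (negbTE w0).
pose v' k := if k == i then w else if k == j then - w else v k.
have v'i : v' i = w by rewrite /v' eqxx.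
have v'j : v' j = - w by rewrite /v' (negbTE ij) eqxx.
have v'B k : k \in B -> v' k = v k.
  by move=> /inB[ki kj _]; rewrite /v' (negbTE ki) (negbTE kj).
exists v'; split.
- move=> k /inA[->|->|kB]; first by rewrite v'i.
    by rewrite v'j uj -opprD normrN.
  by rewrite v'B// v_near.
- move=> k l /inA[->|->|kB] /inA[->|->|lB] //;
    rewrite ?v'i ?v'j ?v'B//; last exact: v_inj.
  + by move=> /wv.
  + by move=> /esym.
  + by move=> /wNv.
  + by move=> /esym/wv.
  + by move=> /esym/wNv.
- move=> k /inA[->|->|kB].
  + by exists j => //; rewrite v'i v'j.
  + by exists i => //; rewrite v'i v'j opprK.
  have [l lB vl] := v_sym k kB; have [_ _ lA] := inB l lB.
  by exists l => //; rewrite !v'B.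
Qed.

(** * Approximation of balanced matrices, and the equality *)

Lemma balanced_norm_closure (C : numClosedFieldType) (n : nat) (T : 'M[C]_n) :
  balanced T -> norm_closure (@comm_nil2 C n) T.
Proof.
move=> balT e e0; have [P [U [Pu trigU TE]]] := trigonalize T.
(* [K - 1] bounds the growth of the norm under conjugation by [P]; the added 1 makes [K] positive
   and the final bound [(K - 1) * (e / K) < e] strict. *)
pose K := n%:R * (n%:R * `|invmx P| * `|P|) + 1.
have K0 : 0 < K by rewrite ltr_wpDl// !mulr_ge0.
have [//||v [v_near v_inj v_sym]] :=
    @symmetric_perturbation C 'I_n (fun i => U i i) (e / K) [set: 'I_n]%SET.
- exact: divr_gt0.
- move=> a; rewrite !(eq_bigl _ _ (@finset.in_setT 'I_n)).
  by have := balanced_alg_mult a balT; rewrite TE !alg_mult_conj_trig.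
(* Only the diagonal moves: [U + E] stays triangular, with diagonal [v]. *)
pose E := diag_mx (\row_i (v i - U i i)).
have UEv i : (U + E) i i = v i by rewrite !mxE eqxx mulr1n addrC subrK.
exists (invmx P *m (U + E) *m P); split.
  apply: comm_nil2_conj => //; apply: comm_nil2_trig.
  - apply/is_trig_mxP => i j ij; rewrite !mxE (is_trig_mxP trigU)//.
    by rewrite -val_eqE ltn_eqF// mulr0n addr0.
  - by move=> i j; rewrite !UEv; apply: v_inj; rewrite inE.
  - move=> i; have [j _ vj] := v_sym i (finset.in_setT i).
    by exists j; rewrite !UEv.
have normE : `|E| <= e / K.
  apply: mx_norm_le => [|i j]; first by rewrite ltW// divr_gt0.
  rewrite !mxE; case: eqVneq => _; last by rewrite mulr0n normr0 ltW// divr_gt0.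
  by rewrite mulr1n distrC ltW// v_near ?inE.
rewrite TE mulmxDr mulmxDl opprD addNKr normrN.
apply: le_lt_trans (mx_norm_mulmx _ _) _.
apply: (@le_lt_trans _ _ ((K - 1) * (e / K))).
  rewrite addrK -!mulrA ler_wpM2l//.
  rewrite (_ : n%:R * _ = (n%:R * (`|invmx P| * (e / K))) * `|P|); last first.
    by rewrite -!mulrA; do 2 congr (_ * _); rewrite mulrC -!mulrA.
  rewrite ler_wpM2r//; apply: le_trans (mx_norm_mulmx _ _) _.
  by rewrite !ler_wpM2l.
by rewrite mulrBl mul1r mulrC divfK ?lt0r_neq0// gtrBl divr_gt0.
Qed.

(* H = C^n, C = complex R (R : realType), B(H) = n x n complex matrices *)
Theorem theorem4p03 (R : realType) (n : nat) :
  @norm_closure (complex R) n (@comm_nil2 (complex R) n) = @Bal (complex R) n.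
Proof.
apply/seteqP; split=> T; last exact: balanced_norm_closure.
move=> clT; apply/char_poly_opp_balanced/norm_closure_char_poly_opp => e e0.
have [X [/comm_nil2_char_poly_opp XE TX]] := clT e e0.
by exists X.
Qed.
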